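(* Let $n\geq 2$ and let $L_n$ be the real left Leibniz algebra with basis $\{e_1,e_2,f_3,\ldots,f_n\}$ whose only non-zero bracket of basis elements is $[e_2,e_1]=e_1$. Then the binary operation $$(x_1,x_2,x_3,\ldots,x_n)\rhd(y_1,y_2,y_3,\ldots,y_n)=(y_1,\ y_2+e^{x_1}y_2,\ y_3,\ldots,y_n)$$ defines on $\mathbb{R}^n$ a Lie rack structure with unit element $1=(0,\ldots,0)$, such that the tangent space $\operatorname{T}_1\mathbb{R}^n$, endowed with the bilinear operation $$[x,y]=\frac{\partial^2}{\partial s\,\partial t}\bigg|_{s,t=0}\gamma_1(s)\rhd\gamma_2(t),$$ where $\gamma_1,\gamma_2\colon[0,1]\to\mathbb{R}^n$ are smooth paths with $\gamma_1(0)=\gamma_2(0)=1$, $\gamma_1'(0)=x$, $\gamma_2'(0)=y$, is a Leibniz algebra isomorphic to $L_n$.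
   Context: A left Leibniz algebra over $\mathbb{R}$ is a real vector space $L$ with a bilinear map $[-,-]\colon L\times L\to L$ such that $[x,[y,z]]=[[x,y],z]+[y,[x,z]]$ for all $x,y,z\in L$. A rack is a set $X$ with a binary operation $\rhd\colon X\times X\to X$ such that $x\rhd(y\rhd z)=(x\rhd y)\rhd(x\rhd z)$ for all $x,y,z\in X$ and all left multiplications $x\rhd -$ are bijections. A rack is pointed if there is an element $1\in X$ (the unit element) with $1\rhd x=x$ and $x\rhd 1=1$ for all $x\in X$. A Lie rack is a pointed rack $(X,\rhd,1)$ such that $X$ is a smooth manifold, $\rhd$ is a smooth map and the left multiplications are diffeomorphisms. $\mathbb{R}^n$ carries its standard smooth structure.
   Formalization: The second coordinate of the operation is taken to be e^{x_1}y_2 instead of the printed y_2+e^{x_1}y_2; with the printed formula 1▷(0,1,0,…,0)=(0,2,0,…,0), so (0,…,0) is not a unit and the claim fails for every n≥2. *)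

(* Defs.v *)
From mathcomp Require Import all_boot all_order all_algebra.
From mathcomp Require Import all_classical all_reals all_analysis.
Set Implicit Arguments.
Unset Strict Implicit.
Unset Printing Implicit Defensive.
Import Order.TTheory GRing.Theory Num.Theory.
Import numFieldNormedType.Exports.
Local Open Scope classical_set_scope.
Local Open Scope ring_scope.

(** * Leibniz algebras *)

Definition leibniz_bracket (R : realType) (L : lmodType R)
    (br : L -> L -> L) : Prop :=
  [/\ forall x, linear (br x),
      forall y, linear (br^~ y) &
      forall x y z, br x (br y z) = br (br x y) z + br y (br x z)].

Definition leibniz_isomorphic (R : realType) (L M : lmodType R)
    (brL : L -> L -> L) (brM : M -> M -> M) : Prop :=
  exists f : {linear L -> M},
    bijective f /\ forall x y, f (brL x y) = brM (f x) (f y).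

(** * Racks *)

Definition rack (X : Type) (op : X -> X -> X) : Prop :=
  (forall x y z, op x (op y z) = op (op x y) (op x z)) /\
  (forall x, bijective (op x)).

Definition pointed_rack (X : Type) (op : X -> X -> X) (e : X) : Prop :=
  rack op /\ forall x, op e x = x /\ op x e = e.

(** * Smoothness *)

(* Meant for finite-dimensional [V], where [C_k k.+1] may be tested on
   directional derivatives. *)
Fixpoint C_k (R : realType) (V W : normedModType R) (k : nat)
    (f : V -> W) : Prop :=
  if k is k'.+1 then
    (forall x, differentiable f x) /\ (forall v, C_k k' ('D_v f))
  else continuous f.

Definition smooth (R : realType) (V W : normedModType R) (f : V -> W) : Prop :=
  forall k, C_k k f.

Definition diffeomorphism (R : realType) (V W : normedModType R)
    (f : V -> W) : Prop :=
  smooth f /\ exists g : W -> V, [/\ cancel f g, cancel g f & smooth g].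

(* The manifold is the vector space [V] with its standard smooth structure. *)
Definition Lie_rack (R : realType) (V : normedModType R)
    (op : V -> V -> V) (e : V) : Prop :=
  [/\ pointed_rack op e,
      smooth (fun p : V * V => op p.1 p.2) &
      forall x, diffeomorphism (op x)].

(** * The bracket on the tangent space at the unit *)

(* [l] is the derivative at [t] of the restriction of [f] to [0, 1]; it is
   one-sided when [t] is an endpoint. *)
Definition is_derive01 (R : realType) (V : normedModType R)
    (f : R -> V) (t : R) (l : V) : Prop :=
  (u - t)^-1 *: (f u - f t) @[u --> within `[0, 1] t^'] --> l.

(* Paths are total functions of which only the restriction to [0, 1] matters;
   [g k] is the [k]-th derivative on [0, 1]. *)
Definition smooth_path (R : realType) (V : normedModType R)
    (c : R -> V) : Prop :=
  exists g : nat -> R -> V,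
    (forall t, t \in `[0, 1] -> g 0%N t = c t) /\
    (forall k t, t \in `[0, 1] -> is_derive01 (g k) t (g k.+1 t)).

(* [D s] is the partial derivative in [t] at [(s, 0)]. *)
Definition is_mixed_derive01 (R : realType) (V : normedModType R)
    (F : R -> R -> V) (l : V) : Prop :=
  exists D : R -> V,
    (forall s, s \in `[0, 1] -> is_derive01 (F s) 0 (D s)) /\
    is_derive01 D 0 l.

(* The tangent space of [V] at [e] is identified with [V]. *)
Definition tangent_bracket (R : realType) (V : normedModType R)
    (op : V -> V -> V) (e : V) (br : V -> V -> V) : Prop :=
  forall (x y : V) (c1 c2 : R -> V),
    smooth_path c1 -> smooth_path c2 ->
    c1 0 = e -> c2 0 = e ->
    is_derive01 c1 0 x -> is_derive01 c2 0 y ->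
    is_mixed_derive01 (fun s t => op (c1 s) (c2 t)) (br x y).

(** * The algebra L_n and the rack operation *)

(* The basis e_1, e_2, f_3, ..., f_n is the standard basis
   [delta_mx 0 i] of R^n, and coordinates are numbered from 0. *)
Definition Ln_basis_bracket (R : realType) (n : nat) (i j : 'I_n) : 'rV[R]_n :=
  if (i == 1%N :> nat) && (j == 0%N :> nat) then delta_mx 0 j else 0.

Definition Ln_bracket (R : realType) (n : nat) (x y : 'rV[R]_n) : 'rV[R]_n :=
  \sum_(i < n) \sum_(j < n) (x 0 i * y 0 j) *: Ln_basis_bracket R i j.

(* The source prints the second coordinate as [y_2 + e^(x_1) y_2]. That is a
   misprint for [e^(x_1) y_2]: with the printed formula no [u] satisfies
   [u |> y = y] for all [y], since [1 + e^(u_1) <> 1]. *)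
Definition rack_op (R : realType) (n : nat) (hn : (2 <= n)%N)
    (x y : 'rV[R]_n) : 'rV[R]_n :=
  \row_j (if j == 1%N :> nat then expR (x 0 (Ordinal (ltnW hn))) * y 0 j
          else y 0 j).

(* Main.v *)
From HB Require Import structures.
Require Import Defs.
From mathcomp Require Import all_boot all_order all_algebra.
From mathcomp Require Import all_classical all_reals all_analysis.
Import Order.TTheory GRing.Theory Num.Theory.
Import numFieldNormedType.Exports.
Local Open Scope classical_set_scope.
Local Open Scope ring_scope.

(** Writing [w] for the second basis vector, the operation is
    [x |> y = (e^(x_1) y_2) w + (y - y_2 w)].  Maps of the form
    [e^l a w + B], with [l], [a], [B] of constant differential, are closed under
    directional derivatives, whence smoothness.  The bracket is
    [[x, y] = x_1 y_2 w]; it is identified by differentiating first in [t],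
    where the operation is linear, and then in [s], by the chain rule for [exp].
    Straight paths show that it is the only candidate, and exchanging the
    first two coordinates turns it into the bracket of [L_n]. *)

(** * Calculus of derivatives restricted to $[0,1]$ *)

Section OneSidedDerivative.
Variables (R : realType) (V W : normedModType R).
Implicit Types (f g : R -> V) (t : R).

(** The filter of right neighbourhoods of $0$ is proper and refines the one defining [is_derive01]
    at $0$, so both values are limits along it in a Hausdorff space. *)
Lemma is_derive01_unique f (l l' : V) :
  is_derive01 f 0 l -> is_derive01 f 0 l' -> l = l'.
Proof.
have sub : (0 : R)^'+ `=>` within [set` `[0, 1]] (0 : R)^'.
  move=> A wA; have : \forall u \near (0 : R)^'+, u \in `[0, 1] -> A u.
    move: wA; apply: (@filterS _ (nbhs (0 : R))) => u uA u0.
    by apply: uA; rewrite gt_eqF.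
  move=> rA; near=> u; apply: (near rA u) => //.
    rewrite in_itv/=; apply/andP; split; first by near: u; exact: nbhs_right_ge.
  by near: u; exact: nbhs_right_le.
have right h m : is_derive01 h 0 m ->
    (u - 0)^-1 *: (h u - h 0 : V) @[u --> (0 : R)^'+] --> m.
  by apply: cvg_trans; exact: cvg_app sub.
by move=> /right fl /right; exact: (cvg_unique (@norm_hausdorff _ _)).
Unshelve. all: end_near. Qed.

Lemma eq_is_derive01 f g t (l : V) :
  t \in `[0, 1] -> (forall u, u \in `[0, 1] -> f u = g u) ->
  is_derive01 f t l -> is_derive01 g t l.
Proof.
move=> t01 fg; apply: cvg_trans; apply: near_eq_cvg.
by apply: filterS (withinT _ _) => u u01; rewrite !fg.
Qed.

Lemma is_derive01_cst (v : V) t : is_derive01 (cst v) t 0.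
Proof.
by apply: cvg_near_cst; near=> u; rewrite subrr scaler0.
Unshelve. all: end_near. Qed.

Lemma is_derive01_scale (v : V) t : is_derive01 (fun u : R => u *: v) t v.
Proof.
apply: cvg_near_cst; apply: cvg_within; near=> u.
rewrite -scalerBl scalerA mulVf ?scale1r// subr_eq0.
by near: u; exact: nbhs_dnbhs_neq.
Unshelve. all: end_near. Qed.

Lemma is_derive01Zl (a : R -> R) (v : V) t (m : R) :
  is_derive01 a t m -> is_derive01 (fun u => a u *: v) t (m *: v).
Proof.
move=> am; rewrite /is_derive01.
under eq_fun do rewrite -scalerBl scalerA.
exact: cvgZr_tmp.
Qed.

Lemma is_derive01D f g t (l m : V) :
  is_derive01 f t l -> is_derive01 g t m -> is_derive01 (f \+ g) t (l + m).
Proof.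
move=> fl gm; rewrite /is_derive01.
under eq_fun do rewrite /= opprD addrACA scalerDr.
exact: cvgD.
Qed.

Lemma is_derive01_linear (L : {linear V -> W}) f t (l : V) :
  {for l, continuous L} -> is_derive01 f t l -> is_derive01 (L \o f) t (L l).
Proof.
move=> Lc fl; rewrite /is_derive01.
under eq_fun do rewrite /= -linearB -linearZ.
exact: (cvg_comp _ _ fl Lc).
Qed.

(** For $u \neq t$, $f(u)$ is $f(t)$ plus $u-t$ times the difference quotient; the quotient
    converges and $u-t$ tends to $0$. *)
Lemma is_derive01_cvg f t (l : V) :
  is_derive01 f t l -> f u @[u --> within [set` `[0, 1]] t^'] --> f t.
Proof.
move=> fl.
have ut0 : u - t @[u --> within [set` `[0, 1]] t^'] --> t - t.
  apply: cvg_within_filter; apply: cvg_within_filter.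
  by apply: cvgB; [exact: cvg_id|exact: cvg_cst].
have := cvgD (cvg_cst (f t)) (cvgZ ut0 fl).
rewrite subrr scale0r addr0 => /(_ _ _ _).
apply: cvg_trans; apply: near_eq_cvg; apply: cvg_within; near=> u.
have ut : u - t != 0 by rewrite subr_eq0; near: u; exact: nbhs_dnbhs_neq.
by rewrite addrfctE /= scalerA divff// scale1r subrKC.
Unshelve. all: end_near. Qed.

End OneSidedDerivative.

(** Carathéodory's factorization of [phi] at [c t] avoids dividing by [c u - c t], which may vanish
    for [u] arbitrarily close to [t]. *)
Lemma is_derive01_comp (R : realType) (phi c : R -> R) (t dphi l : R) :
  is_derive (c t) 1 phi dphi -> is_derive01 c t l ->
  is_derive01 (phi \o c) t (dphi * l).
Proof.
move=> /is_derive1_caratheodory[g [phiE gc <-]] cl.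
rewrite /is_derive01.
under eq_fun do rewrite /= phiE -[_ *: _]/(_ * _) mulrCA.
apply: cvgM => //.
by apply: continuous_cvg gc _; exact: is_derive01_cvg cl.
Qed.

Lemma smooth_path_scale (R : realType) (V : normedModType R) (x : V) :
  smooth_path (fun s : R => s *: x).
Proof.
exists (fun k s => if k is k'.+1 then (if k' is 0%N then x else 0) else s *: x).
split=> // -[|[|k]] t _.
- exact: is_derive01_scale.
- exact: is_derive01_cst.
- exact: is_derive01_cst.
Qed.

Lemma tangent_bracket_unique (R : realType) (V : normedModType R)
    (f br br' : V -> V -> V) :
  tangent_bracket f 0 br -> tangent_bracket f 0 br' -> br = br'.
Proof.
move=> H H'; apply/funext => x; apply/funext => y.
pose c (v : V) (s : R) := s *: v.
have cs v : smooth_path (c v) by exact: smooth_path_scale.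
have c0 v : c v 0 = 0 by exact: scale0r.
have cd v : is_derive01 (c v) 0 v by exact: is_derive01_scale.
have [D [DF D0]] := H x y _ _ (cs x) (cs y) (c0 x) (c0 y) (cd x) (cd y).
have [D' [D'F D'0]] := H' x y _ _ (cs x) (cs y) (c0 x) (c0 y) (cd x) (cd y).
(* The inner derivatives [D] and [D'] agree on $[0,1]$, which is all that the outer derivative
   sees. *)
apply: is_derive01_unique D0 _; apply: eq_is_derive01 D'0.
  by rewrite in_itv/= lexx ler01.
by move=> u u01; exact: is_derive01_unique (D'F u u01) (DF u u01).
Qed.

(** * Smoothness of exponential-affine maps *)

Section ExpSmooth.
Variables (R : realType) (V W : normedModType R).

Lemma is_diff_linear (f : V -> W) x :
  linear f -> continuous f -> is_diff x f f.
Proof.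
move=> linf cf.
pose fM := GRing.isLinear.Build _ _ _ _ f linf.
pose L : {linear V -> W} := HB.pack f fM.
have cL : continuous L by [].
by apply: DiffDef; [exact: (linear_differentiable x cL)|exact: (diff_lin x cL)].
Qed.

Lemma is_diff_expR (x : R) : is_diff x (@expR R) ( *%R (expR x)).
Proof.
have dx : differentiable (@expR R) x by apply/derivable1_diffP/derivable_expR.
apply: DiffDef => //; apply/funext => h.
by rewrite diff1E// derive1E derive_val -[_ *: _]/(_ * _) mulrC.
Qed.

Lemma is_diff_expR_affine (w : W) (l a dl da : V -> R) (B dB : V -> W) x :
  is_diff x l dl -> is_diff x a da -> is_diff x B dB ->
  is_diff x (fun x => (expR (l x) * a x) *: w + B x)
    (fun v => (expR (l x) * (dl v * a x + da v)) *: w + dB v).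
Proof.
move=> Hl Ha BdB; have He := is_diff_expR (l x).
have Hz := is_diff_scalel ((expR \o l) x * a x) w.
have Hm := is_diffM (is_diff_comp Hl He) Ha.
apply: is_diff_eq (is_diffD (is_diff_comp Hm Hz) BdB) _.
apply/funext => v /=; rewrite addrfctE /=; congr (_ *: _ + _).
rewrite -[LHS]/(expR (l x) * da v + a x * (expR (l x) * dl v)).
by rewrite mulrDr addrC mulrCA [a x * _]mulrC.
Qed.

(** The differentials do not depend on the point, so a directional derivative has the same shape
    with the same [l]; the induction on [k] generalizes only [a] and [B]. *)
Lemma C_k_expR_affine k (w : W) (l a dl da : V -> R) (B dB : V -> W) :
  (forall x, is_diff x l dl) -> (forall x, is_diff x a da) ->
  (forall x, is_diff x B dB) ->
  C_k k (fun x => (expR (l x) * a x) *: w + B x).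
Proof.
move=> Hl Ha BdB; elim: k a da B dB Ha BdB => [|k IH] a da B dB Ha BdB.
  move=> x; apply: differentiable_continuous.
  by case: (is_diff_expR_affine w _ _ _ _ _ _ _ (Hl x) (Ha x) (BdB x)).
split=> [x|v].
  by case: (is_diff_expR_affine w _ _ _ _ _ _ _ (Hl x) (Ha x) (BdB x)).
have -> : 'D_v (fun x => (expR (l x) * a x) *: w + B x) =
    fun x => (expR (l x) * (dl v * a x + da v)) *: w + dB v.
  apply/funext => x.
  have [dF dE] := is_diff_expR_affine w _ _ _ _ _ _ _ (Hl x) (Ha x) (BdB x).
  by rewrite deriveE// dE.
(* With [v] fixed, [da v] and [dB v] are constants: they account for the summand [0] and for the
   zero differential of the new [B]. *)
apply: (IH (fun x => dl v * a x + da v) (dl v *: da + 0) (cst (dB v)) 0).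
Qed.

End ExpSmooth.

(** * The rack operation and its tangent algebra *)

Section RackOp.
Variables (R : realType) (n : nat) (hn : (2 <= n)%N).
Let i0 : 'I_n := Ordinal (ltnW hn).
Let i1 : 'I_n := Ordinal hn.
Local Notation op := (@rack_op R n hn).
Implicit Types x y z v : 'rV[R]_n.

Lemma rack_opE x y :
  op x y = (expR (x 0 i0) * y 0 i1) *: delta_mx 0 i1 +
           (y - y 0 i1 *: delta_mx 0 i1).
Proof.
apply/rowP => j; rewrite !mxE eqxx /=.
have -> : (j == 1%N :> nat) = (j == i1) by [].
have [->|_] := eqVneq j i1; first by rewrite !mulr1 subrr addr0.
by rewrite !mulr0 subr0 add0r.
Qed.

Lemma rack_op_linear x : linear (op x).
Proof.
move=> k y z; apply/rowP => j; rewrite !mxE; case: ifP => // _.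
by rewrite mulrDr mulrCA.
Qed.

(** The first coordinate of [op x y] is that of [y], so both sides scale the second coordinate of
    [z] by $e^{x_1}e^{y_1}$. *)
Lemma rack_op_distr x y z : op x (op y z) = op (op x y) (op x z).
Proof.
apply/rowP => j; rewrite !mxE /=.
by case: ifP => j1; rewrite ?j1 // mulrCA.
Qed.

Lemma rack_op0 x : op 0 x = x.
Proof. by apply/rowP => j; rewrite !mxE expR0 mul1r; case: ifP. Qed.

Lemma rack_op_unit x : op x 0 = 0.
Proof. by apply/rowP => j; rewrite !mxE mulr0; case: ifP. Qed.

Lemma rack_opNK x : cancel (op x) (op (- x)).
Proof.
move=> y; apply/rowP => j; rewrite !mxE; case: ifP => j1; rewrite ?j1 //.
by rewrite mulrA -expRD addNr expR0 mul1r.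
Qed.

Lemma rack_opKN x : cancel (op (- x)) (op x).
Proof. by rewrite -{2}[x]opprK; exact: rack_opNK. Qed.

Lemma smooth_rack_op : smooth (fun p : 'rV[R]_n * 'rV[R]_n => op p.1 p.2).
Proof.
move=> k; under eq_fun do rewrite rack_opE.
have cc : continuous (fun p : 'rV[R]_n * 'rV[R]_n => p.2 0 i1).
  move=> p; apply: (@continuous_comp _ _ _ snd (fun y : 'rV[R]_n => y 0 i1)).
    exact: cvg_snd.
  exact: coord_continuous.
pose l (p : 'rV[R]_n * 'rV[R]_n) := p.1 0 i0.
pose a (p : 'rV[R]_n * 'rV[R]_n) := p.2 0 i1.
pose B (p : 'rV[R]_n * 'rV[R]_n) := p.2 - a p *: delta_mx 0 i1.
have la : linear a by move=> c u v; rewrite /a /= !mxE.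
(* Being linear and continuous, [l], [a] and [B] are their own differentials. *)
apply: (C_k_expR_affine _ _ _ _ _ l a l a B B) => p; apply: is_diff_linear.
- by move=> c u v; rewrite /l /= !mxE.
- move=> q; apply: (@continuous_comp _ _ _ fst (fun y : 'rV[R]_n => y 0 i0)).
    exact: cvg_fst.
  exact: coord_continuous.
- exact: la.
- exact: cc.
- by move=> c u v; rewrite /B la scalerDl scalerBr scalerA opprD addrACA.
- move=> q; apply: cvgB; first exact: cvg_snd.
  by apply: cvgZr_tmp; exact: cc.
Qed.

Lemma rack_op_continuous x : continuous (op x).
Proof.
move=> z.
apply: (@continuous_comp _ _ _ (pair x) (fun p => op p.1 p.2)).
  exact: (cvg_pair (cvg_cst x) (@cvg_id _ (nbhs z))).
exact: (smooth_rack_op 0%N).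
Qed.

Lemma smooth_rack_op_left x : smooth (op x).
Proof.
have d0 (y : 'rV[R]_n) : is_diff y (cst (0 : R)) 0 := is_diff_cst _ y.
have dop y : is_diff y (op x) (op x).
  by apply: is_diff_linear; [exact: rack_op_linear|exact: rack_op_continuous].
(* For fixed [x] the map is linear, so it fits the exponential shape with a vanishing first term and
   [B] equal to [op x]. *)
move=> k; rewrite (_ : op x = fun y => (expR (cst 0 y) * cst 0 y) *: 0 + op x y).
  exact: (C_k_expR_affine _ _ _ _ _ _ _ _ _ _ _ d0 d0 dop).
by apply/funext => y; rewrite scaler0 add0r.
Qed.

Lemma rack_op_Lie_rack : Lie_rack op 0.
Proof.
split.
- split; last by move=> x; rewrite rack_op0 rack_op_unit.
  split; first exact: rack_op_distr.
  by move=> x; exists (op (- x)); [exact: rack_opNK|exact: rack_opKN].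
- exact: smooth_rack_op.
- move=> x; split; first exact: smooth_rack_op_left.
  exists (op (- x)); split; [exact: rack_opNK|exact: rack_opKN|].
  exact: smooth_rack_op_left.
Qed.

(** On the standard basis the only non-zero bracket is $[e_1,e_2]=e_2$: the roles of $e_1$ and $e_2$
    in $L_n$ are exchanged. *)
Definition rack_bracket x y : 'rV[R]_n := (x 0 i0 * y 0 i1) *: delta_mx 0 i1.

(** Brackets have first coordinate $0$, so $[[x,y],z]=0$, and $[x,[y,z]]=x_1y_1z_2w$ is symmetric in
    $x$ and $y$. *)
Lemma rack_bracket_leibniz : leibniz_bracket rack_bracket.
Proof.
rewrite /rack_bracket; split=> [x k y z|y k x z|x y z] /=.
- by rewrite !mxE mulrDr mulrCA scalerDl scalerA.
- by rewrite !mxE mulrDl -mulrA scalerDl scalerA.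
- by rewrite !mxE /= !mulr0 mul0r scale0r add0r !mulr1 mulrCA.
Qed.

Lemma is_derive01_rack_opr x (c : R -> 'rV[R]_n) t v :
  is_derive01 c t v -> is_derive01 (fun u => op x (c u)) t (op x v).
Proof.
pose opM := GRing.isLinear.Build _ _ _ _ (op x) (rack_op_linear x).
pose L : {linear _ -> _} := HB.pack (op x) opM.
exact: (@is_derive01_linear _ _ _ L c t v (rack_op_continuous x v)).
Qed.

(** With [y] frozen, only the scalar $e^{c(u)_1}$ in front of $y_2w$ varies. *)
Lemma is_derive01_rack_opl y (c : R -> 'rV[R]_n) t v :
  is_derive01 c t v ->
  is_derive01 (fun u => op (c u) y) t
    ((expR (c t 0 i0) * v 0 i0 * y 0 i1) *: delta_mx 0 i1).
Proof.
move=> cv.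
have c0 : is_derive01 (fun u => c u 0 i0) t (v 0 i0).
  have := cvg_comp _ _ cv (@coord_continuous _ _ _ 0 i0 v).
  by apply: cvg_trans; apply: near_eq_cvg; apply: nearW => u; rewrite /= !mxE.
have ec := is_derive01_comp _ expR _ _ _ _ (is_derive_expR _) c0.
have := is_derive01D _ _ _ _ _ _ _
  (is_derive01Zl _ _ _ (y 0 i1 *: delta_mx 0 i1) _ _ ec)
  (is_derive01_cst _ _ (y - y 0 i1 *: delta_mx 0 i1) t).
rewrite addr0 scalerA; congr is_derive01.
by apply/funext => u /=; rewrite rack_opE scalerA.
Qed.

Lemma tangent_bracket_rack_op : tangent_bracket op 0 rack_bracket.
Proof.
move=> x y c1 c2 _ _ c10 c20 c1x c2y.
(* Linearity of [op (c1 s)] carries the velocity [y] of [c2] to the inner derivative. In the outer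
   one the exponential factor is $1$, since [c1] starts at the unit. *)
exists (fun s => op (c1 s) y); split=> [s _|]; first exact: is_derive01_rack_opr.
by have := is_derive01_rack_opl y _ _ _ c1x; rewrite c10 mxE expR0 mul1r.
Qed.

Lemma Ln_bracketE x y : Ln_bracket x y = (x 0 i1 * y 0 i0) *: delta_mx 0 i0.
Proof.
rewrite /Ln_bracket (bigD1 i1)//= (bigD1 i0)//= !big1 ?addr0.
- by rewrite /Ln_basis_bracket !eqxx.
- move=> i ii; rewrite big1// => j _; rewrite /Ln_basis_bracket.
  by rewrite (negPf (ii : (i != 1%N :> nat))) scaler0.
- move=> j ji; rewrite /Ln_basis_bracket.
  by rewrite (negPf (ji : (j != 0%N :> nat))) andbF scaler0.
Qed.

Lemma rack_bracket_Ln : leibniz_isomorphic rack_bracket (@Ln_bracket R n).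
Proof.
pose s := perm.tperm i0 i1.
have sK : involutive (@col_perm R 1 n s).
  by move=> x; rewrite -col_permM perm.tperm2 col_perm1.
exists (@col_perm R 1 n s); split; first exact: inv_bij.
move=> x y; rewrite Ln_bracketE /rack_bracket linearZ /= !mxE.
rewrite perm.tpermL perm.tpermR; congr (_ *: _); apply/rowP => j.
(* Applying the involution [s] to both sides of [s j == i1] gives [j == i0]. *)
rewrite !mxE eqxx /= -(inj_eq (@perm.perm_inj _ s)) perm.tpermK.
by rewrite perm.tpermR.
Qed.

End RackOp.

Theorem mainTheorem3 (R : realType) (n : nat) (hn : (2 <= n)%N) :
  Lie_rack (@rack_op R n hn) 0 /\
  exists br : 'rV[R]_n -> 'rV[R]_n -> 'rV[R]_n,
    [/\ unique (tangent_bracket (@rack_op R n hn) 0) br,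
        leibniz_bracket br &
        leibniz_isomorphic br (@Ln_bracket R n)].
Proof.
split; first exact: rack_op_Lie_rack.
exists (rack_bracket R n hn); split.
- split; first exact: tangent_bracket_rack_op.
  by move=> br'; apply: tangent_bracket_unique; exact: tangent_bracket_rack_op.
- exact: rack_bracket_leibniz.
- exact: rack_bracket_Ln.
Qed.
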